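(* Suppose that there is an algorithm which, given integers $n\ge 2$, $k\ge 0$, a word $w\in\mathcal{A}_n^*$ and an integer $m\le n-1$, where $m\ge 0$ if $w=\epsilon$ and $m\ge j-1$ if $w=w'\sigma_j$ is non-empty with last letter $\sigma_j$, computes the number $x_{n,k}(w,m)$ using time and space polynomial in $n$ and $k$. Then there is an algorithm which, given $n$ and $k$, generates a random element of $(B_n^+)_k$ with uniform probability (that is, each element of $(B_n^+)_k$ is produced with probability $1/|(B_n^+)_k|$), and whose time and space complexity is polynomial in $n$ and $k$.
   Context: $B_n^+$ is the positive braid monoid, i.e. the submonoid of the braid group $B_n$ generated by the Artin generators $\sigma_1,\ldots,\sigma_{n-1}$; it is presented as a monoid by $\sigma_i\sigma_j=\sigma_j\sigma_i$ for $|i-j|>1$ and $\sigma_i\sigma_j\sigma_i=\sigma_j\sigma_i\sigma_j$ for $|i-j|=1$. The relations are homogeneous, so each $\beta\in B_n^+$ has a well-defined length; $(B_n^+)_k$ is the set of elements of length $k$. Let $\mathcal{A}_n=\{\sigma_1,\ldots,\sigma_{n-1}\}$, let $\mathcal{A}_n^*$ be the free monoid on $\mathcal{A}_n$, $\epsilon$ the empty word. The lex-representative $\omega(\beta)\in\mathcal{A}_n^*$ of $\beta\in B_n^+$ is the smallest word representing $\beta$ in the lexicographic order with $\sigma_1<\sigma_2<\cdots<\sigma_{n-1}$. Let $L_{n,k}=\{\omega(\beta)\mid\beta\in(B_n^+)_k\}$. For $w\in\mathcal{A}_n^*$ and $m\in\{0,\ldots,n-1\}$ (with $m<0$ treated like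 $m=0$ being no restriction), $x_{n,k}(w,m)$ is the number of words in $L_{n,k}$ of the form $ww'$, where $w'\in\mathcal{A}_n^*$ does not start with any of $\sigma_1,\ldots,\sigma_m$. It is assumed that one can draw a uniformly random integer from a given range $\{1,\ldots,N\}$, in time and space polynomial in the number of bits of $N$. Elements of $(B_n^+)_k$ are output as words in $\mathcal{A}_n$. *)

(* Defs.v *)
From HB Require Import structures.
From mathcomp Require Import all_boot all_order all_algebra.
From mathcomp Require Import generic_quotient boolp.

Set Implicit Arguments.
Unset Strict Implicit.
Unset Printing Implicit Defensive.

Import Order.TTheory GRing.Theory Num.Theory.

(* Words over the Artin generators: the ordinal i : 'I_n.-1 stands for        *)
(* sigma_(i+1), so that the order of the ordinals is sigma_1 < sigma_2 < ...  *)
Notation letter n := 'I_n.-1.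
Notation word n := (seq 'I_n.-1).

Inductive artin_rel (n : nat) : word n -> word n -> Prop :=
| Artin_far (i j : letter n) : (i.+1 < j) || (j.+1 < i) ->
    artin_rel [:: i; j] [:: j; i]
| Artin_near (i j : letter n) : (i.+1 == j) || (j.+1 == i) ->
    artin_rel [:: i; j; i] [:: j; i; j].

Inductive braid_cong (n : nat) : word n -> word n -> Prop :=
| Cong_rel p u v s : artin_rel u v -> braid_cong (p ++ u ++ s) (p ++ v ++ s)
| Cong_refl u : braid_cong u u
| Cong_sym u v : braid_cong u v -> braid_cong v u
| Cong_trans v u w : braid_cong u v -> braid_cong v w -> braid_cong u w.

Definition braid_congb (n : nat) (u v : word n) : bool := `[< braid_cong u v >].

Lemma braid_congb_refl n : reflexive (@braid_congb n).
Proof. by move=> u; apply/asboolP; apply: Cong_refl. Qed.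

Lemma braid_congb_sym n : symmetric (@braid_congb n).
Proof.
by move=> u v; apply/idP/idP => /asboolP uv; apply/asboolP; apply: Cong_sym.
Qed.

Lemma braid_congb_trans n : transitive (@braid_congb n).
Proof.
move=> v u w /asboolP uv /asboolP vw; apply/asboolP.
exact: Cong_trans uv vw.
Qed.

Canonical braid_equiv (n : nat) : equiv_rel (word n) :=
  EquivRel (@braid_congb n) (@braid_congb_refl n) (@braid_congb_sym n)
           (@braid_congb_trans n).

(* The positive braid monoid B_n^+, as the quotient of the free monoid. *)
Definition posbraid (n : nat) := {eq_quot (braid_equiv n)}%qT.
HB.instance Definition _ (n : nat) := EqQuotient.on (posbraid n).

Definition braid_of (n : nat) (u : word n) : posbraid n := \pi_(posbraid n)%qT u.

(* The elements of B_n^+ of length k, listed without repetition; the relations *)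
(* preserve the length of words, so these are the classes of words of length k *)
Definition braids (n k : nat) : seq (posbraid n) :=
  undup [seq braid_of (val u) | u <- enum {: k.-tuple (letter n)}].

(* u = omega(beta) *)
Definition is_lexrep (n : nat) (beta : posbraid n) (u : word n) : Prop :=
  braid_of u = beta /\
  forall v : word n, braid_of v = beta -> ((u : seqlexi (letter n)) <= v)%O.

Definition lexreps (n k : nat) : {set k.-tuple (letter n)} :=
  [set u | `[< exists2 beta, beta \in braids n k & is_lexrep beta (val u) >]].

(* w does not start with any of sigma_1, ..., sigma_m *)
Definition avoids_start (n m : nat) (w : word n) : bool :=
  if w is i :: _ then m <= i else true.

Definition xcount (n k : nat) (w : word n) (m : nat) : nat :=
  #|[set u in lexreps n k |
       `[< exists2 w' : word n, val u = w ++ w' & avoids_start m w' >] ]|.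

(* Algorithms are programs of a structured logarithmic-cost machine with      *)
(* finitely many registers (holding natural numbers) and stacks (of natural   *)
(* numbers), extended by an instruction drawing a uniformly random integer.   *)
(* An instruction costs the total bit length of its operands, plus one, so    *)
(* that time and space agree up to a polynomial with those of multitape       *)
(* Turing machines (a tape being a pair of stacks).                           *)
Inductive cmd : Type :=
| Skip
| Const (x c : nat)          (* x := c *)
| Add (x y z : nat)          (* x := y + z *)
| Sub (x y z : nat)          (* x := max (y - z) 0 *)
| Push (a x : nat)           (* push the content of x on stack a *)
| Pop (x a : nat)            (* x := top of stack a, or 0 if a is empty *)
| Test (x a : nat)           (* x := 0 if stack a is empty, 1 otherwise *)
| Draw (x y : nat)           (* x := random element of {1, ..., y} *)
| Seq (c1 c2 : cmd)
| If (x : nat) (c1 c2 : cmd) (* test x <> 0 *)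
| While (x : nat) (c : cmd). (* while x <> 0 *)

(* All registers and stacks mentioned in c have an index < width c. *)
Fixpoint width (c : cmd) : nat :=
  match c with
  | Skip => 0
  | Const x _ => x.+1
  | Add x y z | Sub x y z => maxn x.+1 (maxn y.+1 z.+1)
  | Push a x | Pop x a | Test x a => maxn a.+1 x.+1
  | Draw x y => maxn x.+1 y.+1
  | Seq c1 c2 => maxn (width c1) (width c2)
  | If x c1 c2 => maxn x.+1 (maxn (width c1) (width c2))
  | While x c => maxn x.+1 (width c)
  end.

(* code is the list of commands that remain to be executed; clock is the time *)
(* used so far.                                                               *)
Record config := Config {
  code : seq cmd;
  reg : nat -> nat;
  stk : nat -> seq nat;
  clock : nat }.

Definition halted (s : config) : bool := nilp (code s).

(* bit length: 0 for 0, and floor (log2 x) + 1 for x > 0 *)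
Definition bits (x : nat) : nat := up_log 2 x.+1.

(* The number of equally likely outcomes of the next step; drawing from an    *)
(* empty range is, by convention, drawing from {1}.                           *)
Definition outcomes (s : config) : nat :=
  if code s is Draw _ y :: _ then maxn 1 (reg s y) else 1.

(* Costs of drawing from {1, ..., N}, as functions of the bit length of N. *)
Record draw_cost := DrawCost { draw_time : nat -> nat; draw_space : nat -> nat }.

(* step dc r s is the configuration after s when the outcome of the step is   *)
(* r, with 1 <= r <= outcomes s (r only matters for Draw).                    *)
Definition step (dc : draw_cost) (r : nat) (s : config) : config :=
  let: Config k R H t := s in
  match k with
  | [::] => s
  | Skip :: k' => Config k' R H t.+1
  | Const x c :: k' => Config k' [eta R with x |-> c] H (t + (bits c).+1)
  | Add x y z :: k' =>
      Config k' [eta R with x |-> R y + R z] H (t + (bits (R y) + bits (R z)).+1)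
  | Sub x y z :: k' =>
      Config k' [eta R with x |-> R y - R z] H (t + (bits (R y) + bits (R z)).+1)
  | Push a x :: k' =>
      Config k' R [eta H with a |-> R x :: H a] (t + (bits (R x)).+1)
  | Pop x a :: k' =>
      Config k' [eta R with x |-> head 0 (H a)] [eta H with a |-> behead (H a)]
             (t + (bits (head 0 (H a))).+1)
  | Test x a :: k' =>
      Config k' [eta R with x |-> nat_of_bool (~~ nilp (H a))] H t.+1
  | Draw x y :: k' =>
      Config k' [eta R with x |-> r] H
             (t + (bits (R y)).+1 + draw_time dc (bits (R y)))
  | Seq c1 c2 :: k' => Config [:: c1, c2 & k'] R H t.+1
  | If x c1 c2 :: k' =>
      Config ((if R x == 0 then c2 else c1) :: k') R H (t + (bits (R x)).+1)
  | While x c :: k' =>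
      Config (if R x == 0 then k' else [:: c, While x c & k']) R H
             (t + (bits (R x)).+1)
  end.

Inductive reach (dc : draw_cost) (s : config) : config -> Prop :=
| Reach_refl : reach dc s s
| Reach_step s' r : reach dc s s' -> 1 <= r <= outcomes s' ->
    reach dc s (step dc r s').

(* Size of the registers and stacks of index < b. *)
Definition memory (b : nat) (s : config) : nat :=
  \sum_(i < b) bits (reg s i) + \sum_(i < b) \sum_(x <- stk s i) (bits x).+1.

(* Memory in use, with what the next step needs if it is a draw. *)
Definition space (dc : draw_cost) (b : nat) (s : config) : nat :=
  memory b s +
  (if code s is Draw _ y :: _ then draw_space dc (bits (reg s y)) else 0).

(* Whatever the outcomes of the draws, the run from s takes time at most T,   *)
(* uses space at most M, and ends in a configuration satisfying Q. Since      *)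
(* every step from a configuration that is not halted increases the clock,    *)
(* the bound on the clock forces termination within T steps.                  *)
Definition runs_within (dc : draw_cost) (b : nat) (s : config) (T M : nat)
    (Q : config -> Prop) : Prop :=
  forall s', reach dc s s' ->
    [/\ clock s' <= T, space dc b s' <= M & halted s' -> Q s'].

(* The probability that the run from s halts after at most t steps, in a      *)
(* configuration satisfying E.                                                *)
Fixpoint prob (dc : draw_cost) (t : nat) (E : config -> bool) (s : config) : rat :=
  if halted s then (E s)%:R%R
  else if t is t'.+1 then
    ((\sum_(1 <= r < (outcomes s).+1) prob dc t' E (step dc r s))
       / (outcomes s)%:R)%R
  else 0%R.

(* On a stack, sigma_j is stored as the integer j, the first letter of a word *)
(* being on top.                                                              *)
Definition encode (n : nat) (w : word n) : seq nat := [seq (val i).+1 | i <- w].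

(* The input (n, k, m, w): n, k, m in the registers 0, 1, 2, and w on the     *)
(* stack 0; everything else is empty.                                         *)
Definition init (c : cmd) (n k m : nat) (w : word n) : config :=
  Config [:: c] [eta fun=> 0 with 0 |-> n, 1 |-> k, 2 |-> m]
         [eta fun=> [::] with 0 |-> encode w] 0.

(* Number of registers and stacks of c, including those for the input. *)
Definition nvars (c : cmd) : nat := maxn 3 (width c).

Definition polybound (f : nat -> nat) : Prop :=
  exists a d : nat, forall b, f b <= a * b.+1 ^ d.

(* A function of n and k is bounded by a polynomial iff it is bounded by      *)
(* some bound2 a d.                                                           *)
Definition bound2 (a d n k : nat) : nat := a * (n + k).+1 ^ d.

(* As usual, the space taken by the input itself is not charged: w may be     *)
(* arbitrarily long, while the bounds only depend on n and k.                 *)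
Definition polytime_counts (dc : draw_cost) (c : cmd) : Prop :=
  exists a d : nat, forall (n k : nat) (w : word n) (m : nat),
    1 < n -> m <= n.-1 ->
    (* m >= j - 1 if w ends with sigma_j *)
    (forall (w' : word n) (j : letter n), w = rcons w' j -> j <= m) ->
    let s := init c k m w in
    runs_within dc (nvars c) s
      (bound2 a d n k) (memory (nvars c) s + bound2 a d n k)
      (fun s' => reg s' 0 = xcount k w m).

Definition outputs (n : nat) (beta : posbraid n) (s : config) : bool :=
  `[< exists2 w : word n, stk s 0 = encode w & braid_of w = beta >].

Definition polytime_samples_uniformly (dc : draw_cost) (c : cmd) : Prop :=
  exists a d : nat, forall n k : nat, 1 < n ->
    let s := @init c n k 0 [::] in
    runs_within dc (nvars c) s (bound2 a d n k) (bound2 a d n k)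
      (fun s' => exists2 beta, beta \in braids n k & outputs beta s') /\
    forall beta, beta \in braids n k ->
      prob dc (bound2 a d n k) (outputs beta) s = (1 / (size (braids n k))%:R)%R.

(* Main.v *)
Require Import Defs.
From mathcomp Require Import all_boot all_order all_algebra.
From mathcomp Require Import generic_quotient boolp zify.

Set Implicit Arguments.
Unset Strict Implicit.
Unset Printing Implicit Defensive.

Import Order.TTheory GRing.Theory Num.Theory.

(* A lex-representative is built letter by letter. After drawing [r] in
   {1, ..., x_{n,k}(eps,0)}, one looks for the lex-representative [u] of rank
   [r]. While the prefix [w] of [u] is known, one keeps the number [T] of
   lex-representatives that extend [w], and the rank of [u] among them. Lowering
   [T] to x_{n,k}(w,m) for increasing [m] removes those whose next letter is
   sigma_m, and the next letter of [u] is the first one for which the rank does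
   not exceed the number of removed words. The numbers x_{n,k}(w,m) are only
   available for m >= j - 1 if w ends with sigma_j, but this suffices: by far
   commutation, no letter below sigma_{j-1} follows sigma_j in a
   lex-representative, and the words that continue with sigma_{j-1} are
   accounted for by [T], which is known from the previous prefix.

   The program for x_{n,k} may itself draw random numbers, but its result does
   not depend on them, and the traces that it leaves in memory are erased after
   each call; thus the run of the sampler is deterministic up to its clock,
   except for the draw of [r]. A step increases the memory by at most its cost,
   so that the bound on the space follows from the bound on the time. *)

(** * Runs of programs *)

Lemma leq_bits x y : x <= y -> bits x <= bits y.
Proof. by move=> xy; apply: leq_up_log. Qed.

Lemma bits_le_exp x k : x < 2 ^ k -> bits x <= k.
Proof. exact: up_log_min. Qed.

Lemma bits_le_self x : bits x <= x.
Proof. by apply: bits_le_exp; apply: ltn_expl. Qed.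

Lemma ltn_exp_bits x : x < 2 ^ bits x.
Proof. exact: up_logP. Qed.

Lemma bits_add x y : bits (x + y) <= (bits x + bits y).+1.
Proof.
apply: bits_le_exp; have := ltn_exp_bits x; have := ltn_exp_bits y.
rewrite expnS expnD; set a := 2 ^ bits x; set b := 2 ^ bits y => yb xa.
have : 0 < a by rewrite expn_gt0.
have : 0 < b by rewrite expn_gt0.
nia.
Qed.

(** * Halting along every branch of the draws, and sequential composition *)

Section Machine.
Variable dc : draw_cost.
Implicit Types (s : config) (Q : config -> Prop).

Lemma outcomes_gt0 s : 0 < outcomes s.
Proof. by case: s => [[|[]]] * //=; rewrite leq_max. Qed.

Lemma step_clock r s : ~~ halted s -> clock s < clock (step dc r s).
Proof. by case: s => [[|[]]] * //=; lia. Qed.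

Lemma step_halted r s : halted s -> step dc r s = s.
Proof. by case: s => [[|[]]]. Qed.

(** Well-founded form of total correctness: all branches of the tree of outcomes are finite, so that
    proofs go by induction on this tree instead of on a time bound. *)
Inductive ends_in Q : config -> Prop :=
| Ends_halt s : halted s -> Q s -> ends_in Q s
| Ends_step s : ~~ halted s ->
    (forall r, 1 <= r <= outcomes s -> ends_in Q (step dc r s)) -> ends_in Q s.

Lemma ends_in_impl Q Q' s : (forall s', Q s' -> Q' s') -> ends_in Q s ->
  ends_in Q' s.
Proof.
move=> QQ'; elim=> {}s hs; first by move/QQ'; apply: Ends_halt.
by move=> _ IH; apply: Ends_step.
Qed.

Lemma ends_in_reach Q s s' : ends_in Q s -> reach dc s s' -> ends_in Q s'.
Proof.
move=> evs; elim=> // {}s' r _ evs' r_ok.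
case: evs' r_ok => {}s' hs' evs' r_ok; last exact: evs'.
by rewrite step_halted //; apply: Ends_halt.
Qed.

(** The clock only increases, and the outcome 1 is always possible, so some branch leads from [s] to
    an end. With [ends_in_reach] this bounds the clock at every reachable configuration. *)
Lemma ends_in_clock Q s D : ends_in Q s -> (forall s', Q s' -> clock s' <= D) ->
  clock s <= D.
Proof.
move=> + QD; elim=> {}s hs; first exact: QD.
move=> _ /(_ 1); rewrite outcomes_gt0 => /(_ isT).
by apply: leq_trans; apply/ltnW/step_clock.
Qed.

Definition add_code s K := Config (code s ++ K) (reg s) (stk s) (clock s).

Lemma step_add_code r s K : ~~ halted s ->
  step dc r (add_code s K) = add_code (step dc r s) K.
Proof.
by case: s => [[|[]]] //= *; rewrite /add_code /=; case: ifP.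
Qed.

Lemma outcomes_add_code s K : ~~ halted s ->
  outcomes (add_code s K) = outcomes s.
Proof. by case: s => [[|[]]]. Qed.

Lemma halted_add_code s K : ~~ halted s -> ~~ halted (add_code s K).
Proof. by case: s => [[|]]. Qed.

(** A step looks only at the first command, so [K] stays untouched until the code in front of it is
    used up. *)
Lemma ends_in_cat Q K s :
  ends_in (fun s => ends_in Q (Config K (reg s) (stk s) (clock s))) s ->
  ends_in Q (add_code s K).
Proof.
elim=> {}s hs; first by case: s hs => [[|c k] R H t].
move=> _ IH; apply: Ends_step => [|r]; first exact: halted_add_code.
by rewrite outcomes_add_code // step_add_code //; apply: IH.
Qed.

Lemma runs_within_ev b s T M Q : runs_within dc b s T M Q ->
  ends_in (fun s' => [/\ clock s' <= T, memory b s' <= M & Q s']) s.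
Proof.
move=> runs.
(* Induction on the time that is left, which each step from a non-halted configuration lowers. *)
suff evr n s' : reach dc s s' -> T - clock s' < n ->
    ends_in (fun s' => [/\ clock s' <= T, memory b s' <= M & Q s']) s'.
  exact: (evr _ s (Reach_refl dc s) (ltnSn _)).
elim: n s' => // n IHn s' rs' ltn.
have [cT sM Qs'] := runs _ rs'; case hs': (halted s').
  apply: Ends_halt => //; split=> //; last exact: Qs'.
  exact: leq_trans (leq_addr _ _) sM.
apply: Ends_step => [|r r_ok]; first by rewrite hs'.
have rs := Reach_step rs' r_ok; apply: IHn => //.
have [] := runs _ rs; have := @step_clock r s'; rewrite hs' => /(_ isT).
lia.
Qed.

(** * Memory grows no faster than the clock *)

Lemma sum_update (A : Type) (F : A -> nat) (f : nat -> A) b x v :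
  \sum_(i < b) F ([eta f with x |-> v] i) <= \sum_(i < b) F (f i) + F v.
Proof.
case: (ltnP x b) => xb.
  rewrite (bigD1 (Ordinal xb)) //= eqxx addnC leq_add2r.
  rewrite [X in _ <= X](bigD1 (Ordinal xb)) //=.
  apply: leq_trans (leq_addl _ _); apply: leq_sum => i.
  by rewrite -val_eqE /= => /negPf ->.
apply: leq_trans (leq_addr _ _); apply: leq_sum => i _ /=.
by case: eqP (ltn_ord i) => // ->; rewrite ltnNge xb.
Qed.

Lemma sum_update_le (A : Type) (F : A -> nat) (f : nat -> A) b x v :
  F v <= F (f x) ->
  \sum_(i < b) F ([eta f with x |-> v] i) <= \sum_(i < b) F (f i).
Proof. by move=> le_v; apply: leq_sum => i _ /=; case: eqP => // ->. Qed.

Lemma sum_push (f : nat -> seq nat) b a x :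
  \sum_(i < b) \sum_(y <- [eta f with a |-> x :: f a] i) (bits y).+1 <=
  \sum_(i < b) \sum_(y <- f i) (bits y).+1 + (bits x).+1.
Proof.
pose G l := \sum_(y <- l) (bits y).+1.
case: (ltnP a b) => ab.
  rewrite (bigD1 (Ordinal ab)) //= eqxx big_cons -addnA addnC leq_add2r.
  rewrite [X in _ <= X](bigD1 (Ordinal ab)) //= leq_add2l.
  by apply: leq_sum => i; rewrite -val_eqE /= => /negPf ->.
apply: leq_trans (leq_addr _ _); apply: leq_sum => i _ /=.
by case: eqP (ltn_ord i) => // ->; rewrite ltnNge ab.
Qed.

Lemma step_memory b r s : 1 <= r <= outcomes s ->
  memory b (step dc r s) + clock s <= memory b s + clock (step dc r s).
Proof.
case: s => [[|c k] R H t] //=.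
rewrite /memory; case: c => /= [|x c|x y z|x y z|a x|x a|x a|x y|c1 c2|x c1 c2|x c].
- lia.
- by have /= := sum_update bits R b x c; lia.
- by have /= := sum_update bits R b x (R y + R z);
  have := bits_add (R y) (R z); lia.
- have /= := sum_update bits R b x (R y - R z);
  have := leq_bits (leq_subr (R z) (R y)).
  lia.
- by have /= := sum_push H b a (R x); lia.
- have /= := sum_update bits R b x (head 0 (H a)).
  have /= := @sum_update_le _ (fun l => \sum_(y <- l) (bits y).+1) H b a (behead (H a)).
  case: (H a) => [|y l] /=; rewrite ?big_cons; lia.
- have /= := sum_update bits R b x (~~ nilp (H a)).
  by have := bits_le_self (~~ nilp (H a)); case: nilp => /=; lia.
- rewrite /outcomes /= => r_ok; have /= := sum_update bits R b x r.
  (* The extra 1 is for the empty range, where [r] is 1 although [bits (R y)] is 0. *)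
  have : bits r <= (bits (R y)).+1.
    case: (R y) r_ok => [|Ry] r_ok.
      have := bits_le_self r; lia.
    by apply: leqW; apply: leq_bits; lia.
  lia.
- lia.
- lia.
- lia.
Qed.

Lemma reach_memory b s s' : reach dc s s' ->
  memory b s' + clock s <= memory b s + clock s'.
Proof.
elim=> [|{}s' r _ IH r_ok]; first by rewrite addnC.
by have := step_memory b r_ok; lia.
Qed.

(** * Hoare triples with running times *)

Definition triple c (R : nat -> nat) (H : nat -> seq nat) T
    (P : (nat -> nat) -> (nat -> seq nat) -> Prop) :=
  forall t, ends_in (fun s => clock s <= t + T /\ P (reg s) (stk s))
               (Config [:: c] R H t).

Lemma triple_le c R H T T' P :
  T <= T' -> triple c R H T P -> triple c R H T' P.
Proof.
by move=> TT' trc t; apply: ends_in_impl (trc t) => s []; split=> //; lia.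
Qed.

Lemma triple_post c R H T (P P' : _ -> _ -> Prop) :
  (forall R' H', P R' H' -> P' R' H') -> triple c R H T P -> triple c R H T P'.
Proof. by move=> PP' trc t; apply: ends_in_impl (trc t) => s []; auto. Qed.

Lemma triple_seq c1 c2 R H T1 T2 P1 P :
  triple c1 R H T1 P1 -> (forall R' H', P1 R' H' -> triple c2 R' H' T2 P) ->
  triple (Seq c1 c2) R H (T1 + T2).+1 P.
Proof.
move=> tr1 tr2 t; apply: Ends_step => // r _ /=.
have /= := @ends_in_cat
  (fun s => clock s <= t + (T1 + T2).+1 /\ P (reg s) (stk s)) [:: c2] (Config [:: c1] R H t.+1).
apply; apply: ends_in_impl (tr1 _) => s [cs /tr2 /(_ (clock s))].
by apply: ends_in_impl => s' []; split=> //; lia.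
Qed.

Lemma triple_while_stop x c R H (P : _ -> _ -> Prop) :
  R x = 0 -> P R H -> triple (While x c) R H 1 P.
Proof.
move=> Rx PRH t; apply: Ends_step => // r _ /=.
by apply: Ends_halt; rewrite /halted /= Rx //; split.
Qed.

Lemma triple_while_loop x c R H T1 T2 P1 P :
  R x != 0 -> triple c R H T1 P1 ->
  (forall R' H', P1 R' H' -> triple (While x c) R' H' T2 P) ->
  triple (While x c) R H ((bits (R x)).+1 + T1 + T2) P.
Proof.
move=> Rx tr1 tr2 t; apply: Ends_step => // r _ /=; rewrite (negPf Rx).
set T := (_ + _ + _)%N; have /= := @ends_in_cat
  (fun s => clock s <= t + T /\ P (reg s) (stk s)) [:: While x c]
  (Config [:: c] R H (t + (bits (R x)).+1)).
apply; apply: ends_in_impl (tr1 _) => s [cs /tr2 /(_ (clock s))].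
by apply: ends_in_impl => s' []; split=> //; lia.
Qed.

Lemma triple_runs_within c R H T P b : triple c R H T P ->
  forall N, (forall b', memory b' (Config [:: c] R H 0) <= N) ->
  forall S, (forall v, v <= N + T -> draw_space dc v <= S) ->
  runs_within dc b (Config [:: c] R H 0) T (N + T + S)
    (fun s => P (reg s) (stk s)).
Proof.
move=> trc N memN S drS s' rs.
have {trc}evs := ends_in_reach (trc 0) rs.
have cT : clock s' <= T by apply: ends_in_clock evs _ => s [].
have mem b' : memory b' s' <= N + T.
  by have := reach_memory b' rs; have := memN b'; rewrite /= addn0; lia.
split=> //; last by case: evs => s1 hs1 => [[_ //]|_ /(negP hs1)].
rewrite /space leq_add ?mem //.
case: (code s') => [|c0 l] //; case: c0 => // x y; apply: drS.
(* The memory bound holds for every window of indices; this one just includes the register [y]. *)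
apply: leq_trans (mem y.+1); rewrite /memory (bigD1 ord_max) //=; lia.
Qed.

(* Once [f] is the number of steps allowed beyond the current time, running   *)
(* until time [D] is long enough for a run that ends by time [D].             *)
Definition yields D E p s := forall f, D <= f + clock s -> prob dc f E s = p.

Lemma yields_halted D E s : halted s -> yields D E ((E s)%:R)%R s.
Proof. by move=> hs [|f] _ /=; rewrite hs. Qed.

(** A step uses one unit of [f] and raises the clock by at least one, so [D <= f + clock s]
    persists, while the probabilities are averaged. *)
Lemma yields_step D E p s : ~~ halted s -> clock s < D ->
  (forall r, 1 <= r <= outcomes s -> yields D E (p r) (step dc r s)) ->
  yields D E ((\sum_(1 <= r < (outcomes s).+1) p r) / (outcomes s)%:R)%R s.
Proof.
move=> hs cD yp [|f] fD /=; first by rewrite add0n leqNgt cD in fD.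
rewrite (negPf hs); congr (_ / _)%R; apply: eq_big_nat => r r_ok.
by apply: yp => //; have := step_clock r hs; lia.
Qed.

Lemma yields_step1 D E p s : ~~ halted s -> clock s < D -> outcomes s = 1 ->
  yields D E p (step dc 1 s) -> yields D E p s.
Proof.
move=> hs cD o1 yp; have := @yields_step D E (fun=> p) s hs cD.
rewrite o1 big_nat1 divr1 => y1; refine (y1 _) => r r_ok.
by have -> : r = 1 by lia.
Qed.

(** A subprogram may draw, but if all its ends lead to the same probability [p], then each average
    over its outcomes is again [p]. *)
Lemma yields_ends_in D E p K Q s : ends_in Q s ->
  (forall s', Q s' -> clock s' <= D /\
     yields D E p (Config K (reg s') (stk s') (clock s'))) ->
  yields D E p (add_code s K).
Proof.
move=> evs Qy; elim: evs => {}s hs.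
  by move/Qy; case: s hs => [[|c k] R H t] // _ [].
move=> evs IH.
have cD : clock s < D.
  apply: leq_trans (step_clock 1 hs) _.
  by apply: ends_in_clock (evs 1 _) _ => [|s' /Qy[]//]; rewrite outcomes_gt0.
have := @yields_step D E (fun=> p) (add_code s K) (halted_add_code _ hs) cD.
rewrite outcomes_add_code // sumr_const_nat subn1 succnK.
rewrite -[(p *+ _)%R]mulr_natr mulfK; last first.
  by rewrite pnatr_eq0 -lt0n outcomes_gt0.
move=> ys; refine (ys _) => r r_ok; rewrite step_add_code //; exact: IH.
Qed.

Lemma triple_yields c R H t T P D E p K : triple c R H T P ->
  (forall R' H' t', P R' H' -> t' <= t + T -> t' <= D /\
     yields D E p (Config K R' H' t')) ->
  yields D E p (Config (c :: K) R H t).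
Proof.
move=> trc Py; apply: (yields_ends_in (K := K) (trc t)) => s' [ct Ps'].
exact: Py.
Qed.

End Machine.

(** * Running a subprogram inside a larger memory *)

Section Frame.
Variables (dc : draw_cost) (B : nat).

(* The variables below B belong to a subprogram, and those from B on to its   *)
(* caller, which lists the values of finitely many of them.                   *)
Definition over (A : Type) (d : A) (low : nat -> A) (s : seq A) (y : nat) : A :=
  if y < B then low y else nth d s (y - B).

Lemma over_high A d low (s : seq A) j : over d low s (B + j) = nth d s j.
Proof. by rewrite /over ltnNge leq_addr addKn. Qed.

Lemma over_low A d low (s : seq A) j : j < B -> over d low s j = low j.
Proof. by rewrite /over => ->. Qed.

Lemma over_set A d low (s : seq A) j v :
  ([eta over d low s with B + j |-> v] : nat -> A) =
    over d low (set_nth d s j v).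
Proof.
apply/funext => y /=; rewrite /over; case: (y =P _) => [->|yj].
  by rewrite ltnNge leq_addr addKn nth_set_nth /= eqxx.
case: ltnP => // By; rewrite nth_set_nth /=; case: (_ =P j) => // yBj.
by case: yj; rewrite -yBj subnKC.
Qed.

Lemma over_set_low A d low (s : seq A) j v : j < B ->
  ([eta over d low s with j |-> v] : nat -> A) =
    over d [eta low with j |-> v] s.
Proof.
by move=> jB; apply/funext => y; rewrite /over /=; case: (y =P j) => // ->;
  rewrite jB.
Qed.

Lemma eq_over A d low low' (s : seq A) : (forall j, j < B -> low j = low' j) ->
  over d low s = over d low' s.
Proof. by move=> eql; apply/funext => y; rewrite /over;
  case: ifP => // /eql. Qed.

(** Commands of width at most [B] read and write only below [B], so each step commutes with [over]
    and with the shift of the clock by [t]. *)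
Lemma ends_in_frame rs hs t Q s : all (fun c => width c <= B) (code s) ->
  ends_in dc (fun s => Q (Config (code s) (over 0 (reg s) rs)
                            (over [::] (stk s) hs) (t + clock s))) s ->
  ends_in dc Q (Config (code s) (over 0 (reg s) rs) (over [::] (stk s) hs)
                  (t + clock s)).
Proof.
move=> + evs; elim: evs => {}s hs0; first by move=> ? _; apply: Ends_halt.
case: s hs0 => [[|c l] R H u] //= _ _ IH /andP[wc wl].
apply: Ends_step => // r r_ok.
case: c wc IH r_ok => /= [|x c|x y z|x y z|a x|x a|x a|x y|c1 c2|x c1 c2|x c];
  rewrite /outcomes /= ?geq_max => wc IH r_ok.
- by rewrite -addnS; apply: (IH 1).
- by have := IH 1 isT wl; rewrite over_set_low // addnA.
- case/and3P: wc => wx wy wz; have := IH 1 isT wl.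
  by rewrite over_set_low // !over_low // addnA.
- case/and3P: wc => wx wy wz; have := IH 1 isT wl.
  by rewrite over_set_low // !over_low // addnA.
- case/andP: wc => wa wx; have := IH 1 isT wl.
  by rewrite over_set_low // !over_low // addnA.
- case/andP: wc => wa wx; have := IH 1 isT wl.
  by rewrite !over_set_low // !over_low // addnA.
- case/andP: wc => wa wx; have := IH 1 isT wl.
  by rewrite over_set_low // !over_low // addnS.
- case/andP: wc => wx wy; have := IH r.
  move: r_ok; rewrite !over_low // => r_ok /(_ r_ok wl).
  by rewrite !over_set_low // !addnA.
- case/andP: wc => w1 w2; have := IH 1 isT.
  by rewrite /= w1 w2 -addnS; apply.
- case/and3P: wc => wx w1 w2; have := IH 1 isT.
  by rewrite /= over_low // addnA; case: ifP => _; rewrite ?w1 ?w2; apply.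
- case/andP: wc => wx w1; have := IH 1 isT.
  by rewrite /= over_low // addnA; case: ifP => _ /=;
     rewrite /= ?geq_max ?wx ?w1; apply.
Qed.

End Frame.

(** * Lex-representatives *)

Definition lexle (n : nat) (u v : word n) : bool :=
  ((u : seqlexi (letter n)) <= v)%O.

Section LexOrder.
Variable n : nat.
Implicit Types (u v w : word n).

Lemma lexle_total u v : lexle u v || lexle v u.
Proof. exact: (@le_total _ (seqlexi (letter n))). Qed.

Lemma lexle_anti u v : lexle u v -> lexle v u -> u = v.
Proof.
by move=> uv vu; apply: (@le_anti _ (seqlexi (letter n))); apply/andP.
Qed.

Lemma lexle_trans v u w : lexle u v -> lexle v w -> lexle u w.
Proof. exact: (@le_trans _ (seqlexi (letter n))). Qed.

Lemma lexle_refl u : lexle u u.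
Proof. exact: (@lexx _ (seqlexi (letter n))). Qed.

Lemma lexle_cons (i j : letter n) u v :
  lexle (i :: u) (j :: v) = (i <= j) && ((j <= i) ==> lexle u v).
Proof. by rewrite /lexle lexi_cons !leEord. Qed.

Lemma lexle_cat w u v : lexle (w ++ u) (w ++ v) = lexle u v.
Proof. by elim: w => //= i w IH; rewrite lexle_cons IH leqnn. Qed.

Lemma braid_ofP u v : (braid_of u = braid_of v) <-> braid_cong u v.
Proof.
split=> [/eqmodP/asboolP //|uv]; apply/eqmodP; exact/asboolP.
Qed.

Lemma braid_cong_size u v : braid_cong u v -> size u = size v.
Proof.
elim=> [p {}u {}v s uv|//|_ _ _ //|_ _ _ _ -> _ //].
by rewrite !size_cat; case: uv.
Qed.

End LexOrder.

(** * Counting and ranking lex-representatives with a given prefix *)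

Section Lexreps.
Variables n k : nat.
Implicit Types (u v : k.-tuple (letter n)) (w : word n) (m : nat).

Lemma mem_braids v : braid_of (val v) \in braids n k.
Proof. by rewrite mem_undup; apply/mapP; exists v; rewrite ?mem_enum. Qed.

Lemma lexrepsP u :
  reflect (forall w, braid_cong w (val u) -> lexle (val u) w)
          (u \in lexreps n k).
Proof.
rewrite inE; apply: (iffP (asboolP _)) => [[beta _ [ub minu]] w wu|minu].
  by apply: minu; rewrite -ub; apply/braid_ofP.
exists (braid_of (val u)); first exact: mem_braids.
by split=> // w /braid_ofP; apply: minu.
Qed.

(** Otherwise far commutation would swap the two letters and give a smaller word of the same
    class. *)
Lemma lexreps_far u (p s : word n) (i j : letter n) :
  u \in lexreps n k -> val u = p ++ [:: j, i & s] -> j <= i.+1.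
Proof.
move=> /lexrepsP minu uE; rewrite leqNgt; apply/negP => ij.
have: lexle (val u) (p ++ [:: i, j & s]).
  apply: minu; rewrite uE.
  apply: (@Cong_rel _ p [:: i; j] [:: j; i] s); apply: Artin_far.
  by rewrite ij.
rewrite uE lexle_cat lexle_cons; case/andP; lia.
Qed.

Lemma lexrep_exists beta : beta \in braids n k ->
  exists2 u, u \in lexreps n k & braid_of (val u) = beta.
Proof.
rewrite mem_undup => /mapP[v0 _ ->].
pose P v := braid_of (val v) == braid_of (val v0).
have Pv0 : P v0 by apply: eqxx.
case: (@Order.TotalTheory.arg_minP _ (seqlexi (letter n)) _ v0 P
  (fun v => val v) Pv0) => u /eqP uv0 minu.
exists u => //; apply/lexrepsP => w wu.
(* The minimum was taken over words of length [k] only; the relations being homogeneous, these are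
   all words of the class. *)
have sw : size w == k by rewrite (braid_cong_size wu) size_tuple.
apply: (minu (Tuple sw)); apply/eqP; rewrite -uv0; exact/braid_ofP.
Qed.

Lemma lexrep_inj : {in lexreps n k &, injective (fun u => braid_of (val u))}.
Proof.
move=> u v /lexrepsP minu /lexrepsP minv /braid_ofP uv.
apply: val_inj; apply: lexle_anti; [apply: minu|exact: minv].
exact: Cong_sym.
Qed.

Lemma size_braids : size (braids n k) = #|lexreps n k|.
Proof.
rewrite cardE -(size_map (fun u => braid_of (val u))); apply: perm_size.
apply: uniq_perm => [||beta]; first exact: undup_uniq.
  rewrite map_inj_in_uniq ?enum_uniq // => u v; rewrite !mem_enum.
  exact: lexrep_inj.
apply/idP/mapP => [/lexrep_exists[u uL <-]|[u _ ->]]; last exact: mem_braids.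
by exists u; rewrite ?mem_enum.
Qed.

(** The words counted by [xcount], with [prefix] and [drop] in place of the existential over the
    remaining word. *)
Definition ext w m : {set k.-tuple (letter n)} :=
  [set v in lexreps n k | prefix w v && avoids_start m (drop (size w) v)].

Lemma mem_ext w m v : (v \in ext w m) =
  [&& v \in lexreps n k, prefix w v & avoids_start m (drop (size w) v)].
Proof. exact: in_set. Qed.

Lemma xcountE w m : xcount k w m = #|ext w m|.
Proof.
apply: eq_card => v; rewrite !inE; congr (_ && _); apply/asboolP/andP.
  by case=> w' -> aw'; rewrite prefix_prefix drop_size_cat.
case=> /prefixP[w' vE]; exists w' => //.
by rewrite -(drop_size_cat w' (erefl (size w))) -vE.
Qed.

Definition ext_le w m u := [set v in ext w m | lexle v u].

Lemma mem_ext_le w m u v :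
  (v \in ext_le w m u) = (v \in ext w m) && lexle (val v) (val u).
Proof. exact: in_set. Qed.

Definition rank u := #|ext_le [::] 0 u|.

Lemma ext_nil0 : ext [::] 0 = lexreps n k.
Proof.
apply/setP=> v; rewrite mem_ext prefix0s drop0 /=.
by case: (val v) => [|i w] /=; rewrite andbT.
Qed.

(** Initial segments of a total order are nested, so those of equal cardinality coincide. *)
Lemma rank_inj : {in lexreps n k &, injective rank}.
Proof.
suff inj u v : u \in lexreps n k -> v \in lexreps n k ->
  lexle (val u) (val v) ->
    rank u = rank v -> u = v.
  move=> u v uL vL eq_uv; case/orP: (lexle_total (val u) (val v)) => le_uv.
    exact: inj.
  by apply/esym/inj.
move=> uL vL uv eq_uv.
have sub : ext_le [::] 0 u \subset ext_le [::] 0 v.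
  apply/subsetP => x; rewrite !mem_ext_le => /andP[-> /=] xu.
  exact: lexle_trans uv.
have /eqP eqs : ext_le [::] 0 u == ext_le [::] 0 v.
  by rewrite eqEcard sub; move: eq_uv; rewrite /rank => ->; rewrite leqnn.
have : v \in ext_le [::] 0 u by rewrite eqs mem_ext_le ext_nil0 vL lexle_refl.
by rewrite mem_ext_le => /andP[_ vu]; apply/val_inj/lexle_anti.
Qed.

Lemma rank_bounds u : u \in lexreps n k -> 1 <= rank u <= #|lexreps n k|.
Proof.
move=> uL; apply/andP; split.
  by apply/card_gt0P; exists u; rewrite mem_ext_le ext_nil0 uL lexle_refl.
by rewrite -ext_nil0; apply: subset_leq_card; apply/subsetP=> v;
  rewrite mem_ext_le => /andP[].
Qed.

(** Pigeonhole: the ranks are distinct and lie in an interval with as many elements as there are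
    words. *)
Lemma rank_surj r : 1 <= r <= #|lexreps n k| ->
  exists2 u, u \in lexreps n k & rank u = r.
Proof.
move=> r_ok; pose s := [seq rank u | u <- enum (lexreps n k)].
have us : uniq s.
  by rewrite map_inj_in_uniq ?enum_uniq // => u v; rewrite !mem_enum;
    apply: rank_inj.
have sub : {subset s <= iota 1 #|lexreps n k|}.
  move=> _ /mapP[u + ->]; rewrite mem_enum mem_iota => /rank_bounds; lia.
have [] := uniq_min_size us sub; first by rewrite size_map size_iota -cardE.
move=> _ /(_ r); rewrite mem_iota add1n ltnS r_ok => /mapP[u].
by rewrite mem_enum => uL ->; exists u.
Qed.

(** As [size w < k], a next letter exists, and the value [true] of [avoids_start] on the empty word
    does not interfere. *)
Lemma in_ext w m v : size w < k ->
  reflect (v \in lexreps n k /\ exists2 a : letter n,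
             m <= a & exists w', val v = w ++ a :: w')
          (v \in ext w m).
Proof.
move=> wk; rewrite mem_ext; apply: (iffP andP) => -[vL].
  case/andP => /prefixP[[|a w'] vE]; rewrite vE drop_size_cat //= => am.
    by have := size_tuple v; rewrite vE cats0 => wk'; rewrite wk' ltnn in wk.
  by split=> //; exists a => //; exists w'.
case=> a am [w' vE]; split=> //.
by rewrite [tval v]vE prefix_prefix drop_size_cat.
Qed.

Lemma ext_sub w m m' : size w < k -> m <= m' -> ext w m' \subset ext w m.
Proof.
move=> wk mm'; apply/subsetP => v /(in_ext _ _ wk)[vL [a am' vE]].
by apply/(in_ext _ _ wk); split=> //; exists a => //; apply: leq_trans am'.
Qed.

Lemma ext_lt w m u : size w < k -> u \in ext w m -> m < n.-1.
Proof. by move=> wk /(in_ext _ _ wk)[_ [a am _]];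
  apply: leq_ltn_trans am _. Qed.

Lemma ext_le_sub w m u : ext_le w m u \subset ext w m.
Proof. by apply/subsetP=> v; rewrite mem_ext_le => /andP[]. Qed.

(** The words lost between [m.-1] and [m] continue [w] with a letter below [m], hence all precede
    [u]. *)
Lemma ext_skip w m u : size w < k -> u \in ext w m ->
  #|ext_le w m.-1 u| = #|ext w m.-1| - #|ext w m| + #|ext_le w m u|.
Proof.
move=> wk um; have subm := ext_sub wk (leq_pred m).
rewrite -(setIidPr subm) -cardsD -cardsUI.
set D := _ :\: _; suff -> : D :&: ext_le w m u = set0.
  rewrite cards0 addn0; apply: eq_card => v;
    rewrite in_setU in_setD !mem_ext_le.
  case vm: (v \in ext w m) => /=.
    by rewrite (subsetP subm v vm).
  rewrite orbF; case vm1: (v \in ext w m.-1) => //=.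
  move: um vm1 => /(in_ext _ _ wk)[_ [a am [w1 ->]]] /(in_ext _ _ wk)[vL [b bm [w2 vE]]].
  have ltbm : b < m.
    rewrite ltnNge; apply/negP => mb; case/(in_ext _ _ wk): vm.
    by split=> //; exists b => //; exists w2.
  by rewrite vE lexle_cat lexle_cons; lia.
by apply/setP => v; rewrite in_setI in_setD mem_ext_le in_set0;
  case: (v \in ext w m); rewrite ?andbF.
Qed.

(** If [u] is lost itself, its next letter is [m.-1]. The lost words are then those extending the
    longer prefix, and as the surviving words all follow [u], its rank stays the same. *)
Lemma ext_take w m u : size w < k -> u \in ext w m.-1 -> u \notin ext w m ->
  [/\ 0 < m & exists a : letter n, [/\ m = a.+1, u \in ext (rcons w a) 0,
    #|ext w m.-1| - #|ext w m| = #|ext (rcons w a) 0| &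
    #|ext_le w m.-1 u| = #|ext_le (rcons w a) 0 u| ]].
Proof.
move=> wk um1 um; have m0 : 0 < m by case: m um1 um => // ->.
split=> //; move/(in_ext _ _ wk): um1 => [uL [a am [w1 uE]]].
have ltam : a < m.
  rewrite ltnNge; apply/negP => ma; case/negP: um; apply/(in_ext _ _ wk).
  by split=> //; exists a => //; exists w1.
have mE : m = a.+1 by lia.
have rE v : (v \in ext (rcons w a) 0) =
    (v \in lexreps n k) && prefix (rcons w a) v.
  rewrite mem_ext; congr (_ && _); rewrite andbC.
  by case: (drop _ _).
have extE : ext (rcons w a) 0 = ext w m.-1 :\: ext w m.
  apply/setP => v; rewrite rE in_setD; apply/andP/andP => [[vL pv]|].
    have /prefixP[w2] := pv; rewrite cat_rcons => vE; split.
      apply/negP => /(in_ext _ _ wk)[_ [b bm [w3]]].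
      rewrite [val v]vE => /eqP; rewrite eqseq_cat // eqxx /= => /eqP[ab _].
      by move: bm; rewrite -ab mE ltnn.
    by apply/(in_ext _ _ wk); split=> //; exists a => //; exists w2.
  case=> vm /(in_ext _ _ wk)[vL [b bm [w2 vE]]]; split=> //.
  have ltbm : b < m.
    rewrite ltnNge; apply/negP => mb; case/negP: vm; apply/(in_ext _ _ wk).
    by split=> //; exists b => //; exists w2.
  have -> : a = b by apply: val_inj => /=; lia.
  by rewrite [tval v]vE -cat_rcons prefix_prefix.
exists a; split=> //.
- by rewrite rE uL [tval u]uE -cat_rcons prefix_prefix.
- by rewrite extE cardsD (setIidPr (ext_sub wk (leq_pred m))).
apply: eq_card => v; rewrite !mem_ext_le extE in_setD.
case vm: (v \in ext w m); rewrite ?andbT //= andbC /=;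
  apply/negbTE/negP => /andP[vu _].
move: vm vu => /(in_ext _ _ wk)[_ [b bm [w2 ->]]].
by rewrite uE lexle_cat lexle_cons => /andP[]; lia.
Qed.

(** By [lexreps_far] the letter after [j] is at least [j.-1], so the restriction excludes
    nothing. *)
Lemma ext_rcons w (j : letter n) : size w < k.-1 ->
  ext (rcons w j) 0 = ext (rcons w j) j.-1.
Proof.
move=> wk; have wk' : size (rcons w j) < k by rewrite size_rcons; lia.
apply/eqP; rewrite eqEsubset [X in _ && X]ext_sub // andbT.
apply/subsetP => v /(in_ext _ _ wk')[vL [a _ [w' vE]]].
apply/(in_ext _ _ wk'); split=> //; exists a; last by exists w'.
by move: vE; rewrite cat_rcons => /(lexreps_far vL); lia.
Qed.

(** There are at most [n.-1 ^ k] words, which is at most [2 ^ (n * k)]. *)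
Lemma bits_card_lexreps : bits #|lexreps n k| <= (n * k).+1.
Proof.
apply: bits_le_exp; rewrite expnS mul2n -addnn -addn1.
apply: leq_add; last by rewrite expn_gt0.
apply: leq_trans (max_card _) _; rewrite card_tuple card_ord expnM.
case: (posnP k) => [->|k0]; first by rewrite !expn0.
rewrite leq_exp2r //; apply/ltnW.
by apply: leq_trans (ltn_expl n.-1 (ltnSn 1)) _; rewrite leq_exp2l // leq_pred.
Qed.

Lemma leq_card_ext w m : #|ext w m| <= #|lexreps n k|.
Proof. by apply/subset_leq_card/subsetP => v; rewrite mem_ext => /andP[]. Qed.

Lemma leq_card_ext_le w m u : #|ext_le w m u| <= #|lexreps n k|.
Proof. exact: leq_trans (subset_leq_card (ext_le_sub w m u)) (leq_card_ext _ _). Qed.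

Lemma card_lexreps_gt0 : 1 < n -> 0 < #|lexreps n k|.
Proof.
move=> n1; have i0 : letter n by apply: (@Ordinal _ 0); lia.
have [u uL _] := lexrep_exists (mem_braids [tuple i0 | i < k]).
by apply/card_gt0P; exists u.
Qed.

End Lexreps.

(** * Programs *)

Lemma bits0 : bits 0 = 0. Proof. exact: up_log1. Qed.

Lemma bits1 : bits 1 = 1. Proof. exact: up_lognn. Qed.

Local Notation "c1 ;; c2" := (Seq c1 c2) (at level 90, right associativity).

Section Commands.
Variable dc : draw_cost.

Definition is_state R0 H0 (R : nat -> nat) (H : nat -> seq nat) :=
  R = R0 /\ H = H0.

Lemma triple_seqS c1 c2 R H T1 T2 R1 H1 P :
  triple dc c1 R H T1 (is_state R1 H1) -> triple dc c2 R1 H1 T2 P ->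
  triple dc (c1 ;; c2) R H (T1 + T2).+1 P.
Proof. by move=> tr1 tr2; apply: triple_seq tr1 _ => _ _ [-> ->]. Qed.

Lemma triple_skip R H (P : _ -> _ -> Prop) : P R H -> triple dc Skip R H 1 P.
Proof.
by move=> PRH t; apply: Ends_step => // r _; apply: Ends_halt => //=;
  rewrite addn1.
Qed.

Lemma triple_const x v R H :
  triple dc (Const x v) R H (bits v).+1 (is_state [eta R with x |-> v] H).
Proof. by move=> t; apply: Ends_step => // r _; apply: Ends_halt. Qed.

Lemma triple_add x y z R H :
  triple dc (Add x y z) R H (bits (R y) + bits (R z)).+1
         (is_state [eta R with x |-> R y + R z] H).
Proof. by move=> t; apply: Ends_step => // r _; apply: Ends_halt. Qed.

Lemma triple_sub x y z R H :
  triple dc (Defs.Sub x y z) R H (bits (R y) + bits (R z)).+1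
         (is_state [eta R with x |-> R y - R z] H).
Proof. by move=> t; apply: Ends_step => // r _; apply: Ends_halt. Qed.

Lemma triple_push a x R H :
  triple dc (Push a x) R H (bits (R x)).+1
         (is_state R [eta H with a |-> R x :: H a]).
Proof. by move=> t; apply: Ends_step => // r _; apply: Ends_halt. Qed.

Lemma triple_pop x a R H :
  triple dc (Pop x a) R H (bits (head 0 (H a))).+1
    (is_state [eta R with x |-> head 0 (H a)] [eta H with a |-> behead (H a)]).
Proof. by move=> t; apply: Ends_step => // r _; apply: Ends_halt. Qed.

Lemma triple_test x a R H :
  triple dc (Test x a) R H 1
         (is_state [eta R with x |-> nat_of_bool (~~ nilp (H a))] H).
Proof. by move=> t; apply: Ends_step => // r _; apply: Ends_halt;
  rewrite //= addn1. Qed.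

End Commands.

(** * Moving and erasing stacks *)

Section Moves.
Variables (dc : draw_cost) (t f : nat).

Fixpoint pushes (bs : seq nat) : cmd :=
  if bs is b :: bs' then Push b t ;; pushes bs' else Skip.

(** The transfer reverses the stack. Two targets give a copy, and an empty [bs] erases [a]. *)
Definition move_stack (a : nat) (bs : seq nat) : cmd :=
  Test f a ;; While f (Pop t a ;; pushes bs ;; Test f a).

(** The contribution of a stack to [memory]. *)
Definition weight (l : seq nat) : nat := \sum_(x <- l) (bits x).+1.

Definition scratch (R R' : nat -> nat) : Prop :=
  forall y, y != t -> y != f -> R' y = R y.

Lemma scratch_trans R1 R2 R3 : scratch R1 R2 -> scratch R2 R3 -> scratch R1 R3.
Proof. by move=> s12 s23 y yt yf; rewrite s23 // s12. Qed.

Lemma triple_pushes bs R H : uniq bs ->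
  triple dc (pushes bs) R H (size bs * (bits (R t)).+2).+1
    (is_state R (fun y => if y \in bs then R t :: H y else H y)).
Proof.
elim: bs H => [|b bs IH] H /=.
  by move=> _; apply: triple_le (triple_skip _ _).
move=> /andP[b_bs ubs]; apply: triple_le; last first.
  apply: triple_seqS; first exact: triple_push.
  apply: triple_post (IH _ ubs) => R' H' [-> ->]; split=> //.
  apply/funext => y /=; rewrite inE; case: (y =P b) => //= ->.
  by rewrite (negPf b_bs).
by rewrite /= mulSn; lia.
Qed.

Lemma triple_move_stack a bs R H : uniq bs -> a \notin bs ->
  triple dc (move_stack a bs) R H ((2 * size bs + 10) * (weight (H a)).+1)
    (fun R' H' => scratch R R' /\
       H' = fun y => if y == a then [::] else
                     if y \in bs then rev (H a) ++ H y else H y).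
Proof.
move=> ubs a_bs; set p := size bs.
pose loop := While f (Pop t a ;; pushes bs ;; Test f a).
(* Induction on the content of [a]: each round pops one element, and [a_bs] ensures that no push
   refills the stack. *)
have tr_loop l R1 H1 : H1 a = l -> R1 f = nat_of_bool (~~ nilp l) ->
    triple dc loop R1 H1 ((2 * p + 10) * weight l).+1
      (fun R' H' => scratch R1 R' /\
         H' = fun y => if y == a then [::] else
                       if y \in bs then rev l ++ H1 y else H1 y).
  elim: l R1 H1 => [|x l IH] R1 H1 H1a /= R1f.
    apply: triple_le; last first.
      apply: triple_while_stop => //; split; first by [].
      by apply/funext => y; case: eqP => [->|]; rewrite ?if_same.
    by [].
  apply: triple_le; last first.
    apply: triple_while_loop.
    - by rewrite R1f.
    - apply: triple_seqS; first exact: triple_pop.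
      apply: triple_seqS; first exact: triple_pushes.
      exact: triple_test.
    move=> _ _ [-> ->]; apply: triple_post; last first.
      apply: IH; rewrite /= ?eqxx (negPf a_bs) ?eqxx H1a //.
    move=> R' H' [scR ->]; split.
      apply: scratch_trans scR => y yt yf /=.
      by rewrite (negPf yt) (negPf yf).
    apply/funext => y; case: eqP => // /eqP/negPf ya.
    rewrite /= eqxx ya H1a /= rev_cons cat_rcons.
    by case: (y \in bs).
  rewrite R1f bits1 H1a /= eqxx /weight big_cons -/(weight l) -/p; nia.
apply: triple_le; last first.
  apply: triple_seqS; first exact: triple_test.
  apply: triple_post; last by apply: (tr_loop (H a)); rewrite //= eqxx.
  move=> R' H' [scR ->]; split=> //.
  by apply: scratch_trans scR => y yt yf /=; rewrite (negPf yf).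
nia.
Qed.

Definition clear_stacks (l : seq nat) : cmd :=
  foldr (fun a c => move_stack a [::] ;; c) Skip l.

Lemma triple_clear_stacks l R H :
  triple dc (clear_stacks l) R H
    (10 * \sum_(a <- l) weight (H a) + 11 * size l).+1
    (fun R' H' => scratch R R' /\
       H' = fun y => if y \in l then [::] else H y).
Proof.
elim: l R H => [|a l IH] R H /=.
  by apply: triple_le (triple_skip _ _); rewrite ?big_nil.
pose T l := (10 * \sum_(b <- l) weight (H b) + 11 * size l).+1.
apply: (@triple_le _ _ _ _ ((2 * 0 + 10) * (weight (H a)).+1 + T l).+1).
  by rewrite /T big_cons; lia.
apply: triple_seq; first exact: triple_move_stack.
move=> R1 H1 [sc1 H1E]; apply: triple_le; last first.
  apply: triple_post; last exact: IH.
  move=> R2 H2 [sc2 ->]; split; first exact: scratch_trans sc2.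
  apply/funext => y; rewrite inE H1E; case: eqP => //= _.
  by rewrite if_same.
rewrite /T ltnS leq_add2r leq_mul2l leq_sum ?orbT // => b _.
by rewrite H1E /=; case: eqP => // _; rewrite /weight big_nil.
Qed.

Definition clear_regs (l : seq nat) : cmd :=
  foldr (fun x c => Const x 0 ;; c) Skip l.

Lemma triple_clear_regs l R H :
  triple dc (clear_regs l) R H (2 * size l).+1
    (is_state (fun y => if y \in l then 0 else R y) H).
Proof.
elim: l R => [|x l IH] R /=; first exact: triple_skip.
apply: triple_le; last first.
  apply: triple_seqS; first exact: triple_const.
  apply: triple_post; last exact: IH.
  move=> _ _ [-> ->]; split=> //; apply/funext => y /=.
  by rewrite inE; case: eqP => //= _; case: ifP.
by rewrite bits0; lia.
Qed.

End Moves.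

Lemma triple_eq dc c R R' H H' T P : R = R' -> H = H' ->
  triple dc c R' H' T P -> triple dc c R H T P.
Proof. by move=> -> ->. Qed.

(** * Symbolic execution of the caller's commands, whose variables form an explicit list *)

Section OverSteps.
Variables (dc : draw_cost) (B : nat).
Local Notation over := (over B).
Implicit Types (low : nat -> nat) (s : seq nat).

Lemma step_const i v low s H c T P :
  triple dc c (over 0 low (set_nth 0 s i v)) H T P ->
  triple dc (Const (B + i) v ;; c) (over 0 low s) H ((bits v).+1 + T).+1 P.
Proof.
by move=> trc; apply: triple_seqS; [exact: triple_const | rewrite over_set].
Qed.

Lemma step_add i j l low s H c T P :
  triple dc c (over 0 low (set_nth 0 s i (nth 0 s j + nth 0 s l))) H T P ->
  triple dc (Add (B + i) (B + j) (B + l) ;; c) (over 0 low s) H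
         ((bits (nth 0 s j) + bits (nth 0 s l)).+1 + T).+1 P.
Proof.
move=> trc; rewrite -(over_high B 0 low s j) -(over_high B 0 low s l).
by apply: triple_seqS; [exact: triple_add | rewrite over_set !over_high].
Qed.

Lemma step_sub i j l low s H c T P :
  triple dc c (over 0 low (set_nth 0 s i (nth 0 s j - nth 0 s l))) H T P ->
  triple dc (Defs.Sub (B + i) (B + j) (B + l) ;; c) (over 0 low s) H
         ((bits (nth 0 s j) + bits (nth 0 s l)).+1 + T).+1 P.
Proof.
move=> trc; rewrite -(over_high B 0 low s j) -(over_high B 0 low s l).
by apply: triple_seqS; [exact: triple_sub | rewrite over_set !over_high].
Qed.

Lemma step_load i j l low s H c T P : i < B ->
  triple dc c (over 0 [eta low with i |-> nth 0 s j + nth 0 s l] s) H T P ->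
  triple dc (Add i (B + j) (B + l) ;; c) (over 0 low s) H
         ((bits (nth 0 s j) + bits (nth 0 s l)).+1 + T).+1 P.
Proof.
move=> iB trc; rewrite -(over_high B 0 low s j) -(over_high B 0 low s l).
by apply: triple_seqS; [exact: triple_add | rewrite over_set_low // !over_high].
Qed.

Lemma step_store i j l low s H c T P : j < B ->
  triple dc c (over 0 low (set_nth 0 s i (low j + nth 0 s l))) H T P ->
  triple dc (Add (B + i) j (B + l) ;; c) (over 0 low s) H
         ((bits (low j) + bits (nth 0 s l)).+1 + T).+1 P.
Proof.
move=> jB trc; rewrite -(over_low 0 low s jB) -(over_high B 0 low s l).
by apply: triple_seqS; [exact: triple_add |
  rewrite over_set over_low // over_high].
Qed.

Lemma step_const_low i v low s H c T P : i < B ->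
  triple dc c (over 0 [eta low with i |-> v] s) H T P ->
  triple dc (Const i v ;; c) (over 0 low s) H ((bits v).+1 + T).+1 P.
Proof.
by move=> iB trc; apply: triple_seqS;
  [exact: triple_const | rewrite over_set_low].
Qed.

Lemma step_push i j low s lowH hs c T P :
  triple dc c (over 0 low s)
    (over [::] lowH (set_nth [::] hs i (nth 0 s j :: nth [::] hs i))) T P ->
  triple dc (Push (B + i) (B + j) ;; c) (over 0 low s) (over [::] lowH hs)
         ((bits (nth 0 s j)).+1 + T).+1 P.
Proof.
move=> trc; rewrite -(over_high B 0 low s j).
by apply: triple_seqS; [exact: triple_push | rewrite over_set !over_high].
Qed.

End OverSteps.

(* Offsets from [B]. [reg_i] counts the letters that are still to be found,   *)
(* [reg_T] and [reg_r] hold the number of candidates and the rank among them, *)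
(* [reg_m] the letter being tried, [reg_x] the last count, [reg_t] and        *)
(* [reg_f] are loop guards and scratch registers.                             *)
Definition reg_n := 0. Definition reg_k := 1. Definition reg_i := 2.
Definition reg_T := 3. Definition reg_r := 4. Definition reg_m := 5.
Definition reg_x := 6. Definition reg_t := 7. Definition reg_f := 8.
Definition reg_zero := 9. Definition reg_one := 10.

Lemma memory_init c n k m (w : word n) b :
  memory b (init c k m w) <= n + k + m + weight (encode w).
Proof.
have h2 : \sum_(i < b) bits ([eta fun=> 0 with 2 |-> m] i) <= bits m.
  apply: leq_trans (sum_update _ _ _ _ _) _.
  by rewrite big1 // => i _; apply: bits0.
have h1 := sum_update bits [eta fun=> 0 with 2 |-> m] b 1 k.
have h0 := sum_update bits [eta fun=> 0 with 1 |-> k, 2 |-> m] b 0 n.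
have s0 : \sum_(i < b) weight ([eta fun=> [::] with 0 |-> encode w] i)
    <= weight (encode w).
  apply: leq_trans (sum_update _ _ _ _ _) _.
  by rewrite big1 // => i _; apply: big_nil.
have := bits_le_self n; have := bits_le_self k; have := bits_le_self m.
by move: h2 h1 h0 s0; rewrite /memory /= /weight; lia.
Qed.

(** * The sampling program and its cost *)

Section Sampler.
Variables (dc : draw_cost) (c : cmd) (B : nat).
Local Notation over := (over B).
Local Notation mv := (move_stack (B + reg_t) (B + reg_f)).

(** The constants in [reg_zero] and [reg_one] turn additions into copies and increments. *)
Definition regs n k i T r m x t f : seq nat :=
  [:: n; k; i; T; r; m; x; t; f; 0; 1].

(* The word is stored backwards on the stack [B], its last letter on top.     *)
Definition call : cmd :=
  Add 0 (B + reg_n) (B + reg_zero) ;;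
  Add 1 (B + reg_k) (B + reg_zero) ;;
  Add 2 (B + reg_m) (B + reg_zero) ;;
  mv (B + 0) [:: B + 1; 0] ;;
  mv (B + 1) [:: B + 0] ;;
  c ;;
  Add (B + reg_x) 0 (B + reg_zero) ;;
  clear_stacks (B + reg_t) (B + reg_f) (iota 0 B) ;;
  clear_regs (iota 0 B) ;;
  Const (B + reg_t) 0 ;;
  Const (B + reg_f) 0 ;;
  Skip.

(** One round rejects a letter: [reg_x] holds the number of words starting with it after the prefix,
    and [reg_t] the truncated difference of the rank and this number, so that 0 means that the
    letter is found. *)
Definition find_letter : cmd :=
  Add (B + reg_r) (B + reg_t) (B + reg_zero) ;;
  Defs.Sub (B + reg_T) (B + reg_T) (B + reg_x) ;;
  Add (B + reg_m) (B + reg_m) (B + reg_one) ;;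
  call ;;
  Defs.Sub (B + reg_x) (B + reg_T) (B + reg_x) ;;
  Defs.Sub (B + reg_t) (B + reg_r) (B + reg_x) ;;
  Skip.

(** After the search, [reg_x] counts the extensions of the longer prefix, and [reg_m] is the code of
    the new letter; one less is the least [m] that the next query allows. *)
Definition append_letter : cmd :=
  Defs.Sub (B + reg_i) (B + reg_i) (B + reg_one) ;;
  call ;;
  Defs.Sub (B + reg_x) (B + reg_T) (B + reg_x) ;;
  Defs.Sub (B + reg_t) (B + reg_r) (B + reg_x) ;;
  While (B + reg_t) find_letter ;;
  Add (B + reg_T) (B + reg_x) (B + reg_zero) ;;
  Push (B + 0) (B + reg_m) ;;
  Defs.Sub (B + reg_m) (B + reg_m) (B + reg_one) ;;
  Skip.

Definition prologue : cmd :=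
  Add (B + reg_n) 0 (B + reg_zero) ;;
  Add (B + reg_k) 1 (B + reg_zero) ;;
  Const 0 0 ;;
  Const 1 0 ;;
  Add (B + reg_i) (B + reg_k) (B + reg_zero) ;;
  Const (B + reg_one) 1 ;;
  call ;;
  Add (B + reg_T) (B + reg_x) (B + reg_zero) ;;
  Skip.

Definition epilogue : cmd := While (B + reg_i) append_letter ;; mv (B + 0) [:: 0].

Definition sampler : cmd := prologue ;; Draw (B + reg_r) (B + reg_T) ;;
  epilogue.

Variables (n k a d : nat).
Hypotheses (n1 : 1 < n) (B_gt2 : 2 < B) (width_c : width c <= B).

(** The length bound is added to the precondition of the counting program so that the input word
    itself takes polynomial space. *)
Definition valid (w : word n) (m : nat) : Prop :=
  [/\ size w <= k, m <= n.-1 &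
      forall (w' : word n) (j : letter n), w = rcons w' j -> j <= m].

Hypothesis count_c : forall (w : word n) (m : nat), valid w m ->
  let s := init c k m w in
  runs_within dc B s
    (bound2 a d n k) (memory B s + bound2 a d n k)
    (fun s' => reg s' 0 = xcount k w m).

Let low0 : nat -> nat := fun=> 0.
Let lowH0 : nat -> seq nat := fun=> [::].
Local Notation stacks w := (over [::] lowH0 [:: rev (encode w); [::]]).

(* Bounds the bit length of every register of the sampler.                    *)
Definition value_bits := (n * k + n + k).+1.
(* Bounds the weight of the stack that holds the current word.                *)
Definition word_weight := k * n.+1.
Definition counter_memory := 2 * n + k + word_weight + bound2 a d n k.
Definition call_cost :=
  100 * (value_bits + word_weight + counter_memory + B).+1.

Lemma weight_encode (w : word n) : size w <= k ->
  weight (encode w) <= word_weight.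
Proof.
move=> wk; rewrite /weight big_map.
apply: (@leq_trans (\sum_(j <- w) n.+1)); last first.
  by rewrite big_const_seq count_predT iter_addn_0 mulnC leq_mul2r wk orbT.
apply: leq_sum => j _; rewrite ltnS; apply: leq_trans (bits_le_self _) _ => /=.
have := ltn_ord j; lia.
Qed.

Lemma weight_rev l : weight (rev l) = weight l.
Proof. by rewrite /weight; apply: perm_big; rewrite perm_rev. Qed.

(** The final [low] and [lowH] may depend on draws of [c]. Only the result and the weight of the
    stacks, which bounds the cost of erasing them, are kept. *)
Lemma triple_counter (w : word n) m s : valid w m ->
  triple dc c (over 0 (reg (init c k m w)) s)
    (over [::] (stk (init c k m w)) [:: rev (encode w); [::]])
    (bound2 a d n k)
    (fun R H => exists2 low, low 0 = xcount k w m &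
       exists2 lowH : nat -> seq nat,
         \sum_(i < B) weight (lowH i) <= counter_memory &
         R = over 0 low s /\ H = over [::] lowH [:: rev (encode w); [::]]).
Proof.
move=> wm t; have := runs_within_ev (count_c wm).
set s0 := init c k m w => evc.
have := @ends_in_frame dc B s [:: rev (encode w); [::]] t _ s0.
rewrite /s0 /= addn0; apply; first by rewrite andbT.
apply: ends_in_impl evc => s' [ck mem out] /=; split; first by lia.
exists (reg s') => //; exists (stk s') => //.
have [wk mn _] := wm; have := weight_encode wk.
have := memory_init c k m w B; move: mem;
  rewrite /memory /counter_memory /weight /=.
lia.
Qed.

Lemma scratch_over low i T r m x t f R :
  scratch (B + reg_t) (B + reg_f) (over 0 low (regs n k i T r m x t f)) R ->
  exists t' f', R = over 0 low (regs n k i T r m x t' f').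
Proof.
move=> scR; exists (R (B + reg_t)), (R (B + reg_f)); apply/funext => y.
case: (y =P B + reg_t) => [->|/eqP yt]; first by rewrite over_high.
case: (y =P B + reg_f) => [->|/eqP yf]; first by rewrite over_high.
rewrite scR // /over; case: ltnP => // By.
(* The offsets 7 and 8 are [reg_t] and [reg_f], the only places where the two lists may differ. *)
have : y - B != 7 by apply: contra yt => /eqP e; rewrite -(subnK By) e addnC.
have : y - B != 8 by apply: contra yf => /eqP e; rewrite -(subnK By) e addnC.
by move: (y - B) => j; do 9!case: j => [|j] //.
Qed.

Lemma triple_call_tail low (lowH : nat -> seq nat) hs i T r m x t f :
  \sum_(j < B) weight (lowH j) <= counter_memory ->
  bits (low 0) <= value_bits ->
  triple dc
    (Add (B + reg_x) 0 (B + reg_zero) ;;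
     clear_stacks (B + reg_t) (B + reg_f) (iota 0 B) ;; clear_regs (iota 0 B) ;;
     Const (B + reg_t) 0 ;; Const (B + reg_f) 0 ;; Skip)
    (over 0 low (regs n k i T r m x t f)) (over [::] lowH hs)
    (value_bits + 10 * counter_memory + 13 * B + 20)
    (is_state (over 0 low0 (regs n k i T r m (low 0) 0 0)) (over [::] lowH0 hs)).
Proof.
move=> sumM bV; apply: triple_le; last first.
  apply: step_store => /=; first exact: leq_trans B_gt2.
  apply: triple_seq; first exact: triple_clear_stacks.
  rewrite addn0; move=> R H [/scratch_over[t' [f' ->]] ->].
  apply: triple_seqS; first exact: triple_clear_regs.
  have -> : (fun y => if y \in iota 0 B then 0
                      else over 0 low (regs n k i T r m (low 0) t' f') y) =
      over 0 low0 (regs n k i T r m (low 0) t' f').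
    by apply/funext => y; rewrite mem_iota /= add0n /over; case: ltnP.
  have -> : (fun y => if y \in iota 0 B then [::] else over [::] lowH hs y) =
      over [::] lowH0 hs.
    by apply/funext => y; rewrite mem_iota /= add0n /over; case: ltnP.
  do 2!apply: step_const => /=.
  exact: triple_skip.
have -> : iota 0 B = index_iota 0 B by rewrite /index_iota subn0.
rewrite big_mkord (eq_bigr (fun j : 'I_B => weight (lowH j))); last first.
  by move=> j _; rewrite over_low.
rewrite size_iota /= bits0; set S := bigop.body _ _ _;
  have SM : S <= counter_memory := sumM; lia.
Qed.

(** The first transfer puts the word in reading order on stack 0, with a copy on [B + 1] that the
    second one turns back onto [B]. Erasing afterwards makes the final state independent of the
    draws of [c]. *)
Lemma triple_call (w : word n) m i T r x t f : valid w m ->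
  bits (xcount k w m) <= value_bits -> bits m <= value_bits ->
  triple dc call (over 0 low0 (regs n k i T r m x t f)) (stacks w) call_cost
    (is_state (over 0 low0 (regs n k i T r m (xcount k w m) 0 0)) (stacks w)).
Proof.
move=> wm bV bm; have [wk _ _] := wm.
have overB (l : nat -> seq nat) : over [::] l [:: rev (encode w);
  [::]] B = rev (encode w).
  by have := over_high B [::] l [:: rev (encode w); [::]] 0; rewrite addn0.
apply: triple_le; last first.
  apply: step_load => /=; first exact: leq_trans B_gt2.
  apply: step_load => /=; first exact: leq_trans B_gt2.
  apply: step_load => /=; first exact: B_gt2.
  rewrite !addn0.
  apply: triple_seq; first by apply: triple_move_stack; rewrite /= ?inE; lia.
  move=> R H [/scratch_over[t' [f' ->]] ->].
  apply: triple_seq; first by apply: triple_move_stack; rewrite /= ?inE; lia.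
  move=> R' H' [/scratch_over[t'' [f'' ->]] ->].
  apply: (@triple_seq _ _ _ _ _ _ (value_bits + 10 * counter_memory + 13 * B + 20)).
    (* Below [B], the memory is now exactly the initial one of the counting program. *)
    apply: triple_eq; last exact: (@triple_counter w m (regs n k i T r m x t'' f'')).
      by apply: eq_over; do 3!case=> //.
    apply/funext => y; rewrite /= !inE !eqxx /=.
    case: (y =P B + 1) => [->|y1]; first by rewrite over_high.
    case: (y =P B) => [->|yB] /=.
      by rewrite ifF ?over_high ?overB ?revK ?cats0 //; lia.
    case: (y =P 0) => [->|y0]; first by rewrite overB revK !over_low ?cats0 //;
      lia.
    by rewrite /over; case: ltnP => yB' //=; case: eqP => //;
      rewrite !nth_default //=; lia.
  move=> R'' H'' [low low0E [lowH sumM [-> ->]]].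
  rewrite -low0E; apply: triple_call_tail => //.
  by rewrite low0E.
rewrite /= inE eqxx /= ifF ?overB ?over_high /=; last lia.
rewrite bits0 cats0 !weight_rev.
have := weight_encode wk; have := bits_le_self n; have := bits_le_self k.
rewrite /call_cost; have : bound2 a d n k <= counter_memory by apply: leq_addl.
have : n + k <= value_bits by rewrite /value_bits; lia.
lia.
Qed.

Lemma bits_ext w m (u : k.-tuple (letter n)) :
  (bits #|ext k w m| <= value_bits) * (bits #|ext_le w m u| <= value_bits).
Proof.
have le x : x <= #|lexreps n k| -> bits x <= value_bits.
  move/leq_bits/leq_trans; apply; apply: leq_trans (bits_card_lexreps n k) _.
  by rewrite /value_bits; lia.
by split; apply: le; rewrite (leq_card_ext, leq_card_ext_le).
Qed.

Lemma bits_subV x y : bits x <= value_bits -> bits (x - y) <= value_bits.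
Proof. exact/leq_trans/leq_bits/leq_subr. Qed.

Lemma bits_small m : m <= n.-1 -> bits m <= value_bits.
Proof.
by move=> mn; apply: leq_trans (bits_le_self m) _; rewrite /value_bits; lia.
Qed.

Ltac bits_lia :=
  repeat match goal with |- context [bits ?x] => move: (bits x) end;
  lia.

Definition find_letter_cost := call_cost + 12 * value_bits + 40.

(* The machine numbers the letters from 1: when [reg_m] holds [m], the letter  *)
(* being tried is the ordinal [m.-1], and no letter if [m = 0].               *)
Lemma triple_find_letter j (w : word n) m (u : k.-tuple (letter n)) i :
  let x := #|ext k w m.-1| - #|ext k w m| in
  let r := #|ext_le w m.-1 u| in
  size w < k -> u \in ext k w m.-1 -> valid w m -> n.-1 - m <= j ->
  triple dc (While (B + reg_t) find_letter)
    (over 0 low0 (regs n k i #|ext k w m.-1| r m x (r - x) 0)) (stacks w)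
    (j * find_letter_cost + 1)
    (fun R H => exists (a : letter n) T, u \in ext k (rcons w a) 0 /\
       is_state (over 0 low0 (regs n k i T #|ext_le (rcons w a) 0 u| a.+1
                                   #|ext k (rcons w a) 0| 0 0)) (stacks w) R H).
Proof.
elim: j m => [|j IH] m x r wk um1 [_ mn lastw] nj.
all: case um: (u \in ext k w m).
(* No letters are left to try, whereas [u] still has a next letter that is at least [m]. *)
- by have := ext_lt wk um; lia.
- have [m0 [b [mE ub xE rE]]] := ext_take wk um1 (negbT um).
  have rx0 : r - x = 0.
    by apply/eqP; rewrite subn_eq0 /r /x xE rE;
      apply/subset_leq_card/ext_le_sub.
  apply: triple_while_stop; first by rewrite over_high.
  exists b, #|ext k w m.-1|; split=> //; rewrite rx0 /x /r xE rE -mE.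
  by split.
- have mn1 := ext_lt wk um.
  (* The rank exceeds the number [x] of removed words, as [u] itself survives; so the guard is
     positive. *)
  have rE : r = x + #|ext_le w m u| := ext_skip wk um.
  have le0 : 0 < #|ext_le w m u|.
    by apply/card_gt0P; exists u; rewrite mem_ext_le um lexle_refl.
  have TE : #|ext k w m.-1| - x = #|ext k w m|.
    by rewrite /x subKn //; apply/subset_leq_card/ext_sub/leq_pred.
  have valid1 : valid w m.+1 by split=> // [|w' b /lastw]; lia.
  have rxE : r - x = #|ext_le w m u| by rewrite rE addKn.
  apply: triple_le; last first.
    apply: triple_while_loop.
    - by rewrite over_high /=; lia.
    - apply: step_add => /=; apply: step_sub => /=; apply: step_add => /=.
      rewrite addn0 addn1 TE rxE.
      apply: triple_seqS.
        apply: triple_call => //; last exact: bits_small.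
        by rewrite xcountE (bits_ext _ _ u).
      rewrite xcountE; do 2!apply: step_sub => /=.
      exact: (@triple_skip _ _ _ (is_state _ _)).
    move=> _ _ [-> ->]; apply: (IH m.+1 wk um valid1); lia.
  have bx := bits_subV #|ext k w m| (bits_ext w m.-1 u).1.
  rewrite over_high /= rxE bits0 bits1 [j.+1 * _]mulSn /find_letter_cost.
  have := (bits_ext w m.-1 u).1; have := (bits_ext w m u).1;
    have := (bits_ext w m u).2.
  have := bits_subV #|ext k w m.+1| (bits_ext w m u).1; have := bits_small mn.
  have := (bits_ext w m.+1 u).1.
  by move: bx; rewrite -/x; bits_lia.
- have [m0 [b [mE ub xE rE]]] := ext_take wk um1 (negbT um).
  have rx0 : r - x = 0.
    by apply/eqP; rewrite subn_eq0 /r /x xE rE;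
      apply/subset_leq_card/ext_le_sub.
  apply: triple_le; last first.
    apply: triple_while_stop; first by rewrite over_high.
    exists b, #|ext k w m.-1|; split=> //; rewrite rx0 /x /r xE rE -mE.
    by split.
  by rewrite addn1.
Qed.

(** The least [m] for which the count at [w] may be queried. *)
Definition lastm (w : word n) : nat := last 0 (map val w).

Lemma lastm_valid (w : word n) : size w <= k -> valid w (lastm w).
Proof.
case: (lastP w) => [|w' j] wk; split=> //.
- by case=> [|? ?] ?.
- by rewrite /lastm map_rcons last_rcons; have := ltn_ord j; rewrite /=; lia.
move=> w'' j' /rcons_inj[_ ->].
by rewrite /lastm map_rcons last_rcons.
Qed.

(** This starts the search at [lastm w]: the known number of all extensions of [w] replaces the
    count at [(lastm w).-1], which in general cannot be queried. *)
Lemma ext_lastm (w : word n) : size w < k -> ext k w (lastm w).-1 = ext k w 0.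
Proof.
case: (lastP w) => [|w' j] // wk.
rewrite /lastm map_rcons last_rcons; apply/esym/ext_rcons.
by move: wk; rewrite size_rcons; lia.
Qed.

Definition append_letter_cost :=
  call_cost + n * find_letter_cost + 20 * value_bits + 60.

(** Induction on the number of missing letters; [x] is arbitrary because each round overwrites
    [reg_x] before reading it. *)
Lemma triple_append_letters i (w : word n) (u : k.-tuple (letter n)) x :
  size w + i = k -> u \in ext k w 0 ->
  triple dc (While (B + reg_i) append_letter)
    (over 0 low0 (regs n k i #|ext k w 0| #|ext_le w 0 u| (lastm w) x 0 0))
    (stacks w)
    (i * append_letter_cost + 1)
    (fun R H => H = stacks (val u)).
Proof.
elim: i w x => [|i IH] w x wi uw.
  apply: triple_le; last first.
    apply: triple_while_stop; first by rewrite over_high.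
    move: uw; rewrite mem_ext prefixE => /and3P[_ /eqP + _].
    rewrite addn0 in wi; rewrite wi -{1}(size_tuple u) take_size => uE.
    by rewrite -uE.
  by rewrite addn1.
have wk : size w < k by lia.
have wv : valid w (lastm w) by apply: lastm_valid; lia.
have [_ mn _] := wv.
have uw' : u \in ext k w (lastm w).-1 by rewrite ext_lastm.
have leE : ext_le w 0 u = ext_le w (lastm w).-1 u by rewrite /ext_le ext_lastm.
pose P1 R H := exists b : letter n, u \in ext k (rcons w b) 0 /\
  is_state (over 0 low0 (regs n k i #|ext k (rcons w b) 0|
    #|ext_le (rcons w b) 0 u| (lastm (rcons w b)) #|ext k (rcons w b) 0| 0 0))
    (stacks (rcons w b)) R H.
apply: triple_le; last first.
  apply: (@triple_while_loop _ _ _ _ _ _ _ P1).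
  - by rewrite over_high.
  - apply: step_sub => /=; rewrite subSS subn0.
    apply: triple_seqS.
      apply: triple_call => //; last exact: bits_small.
      by rewrite xcountE (bits_ext _ _ u).
    rewrite xcountE leE -(ext_lastm wk); do 2!apply: step_sub => /=.
    apply: (@triple_seq _ _ _ _ _ _ (4 * value_bits + 20)).
      apply: triple_find_letter wk uw' wv (leqnn _).
    move=> R H [b [T [ub [-> ->]]]].
    apply: triple_le; last first.
      apply: step_add => /=; apply: step_push => /=; apply: step_sub => /=.
      rewrite addn0 subn1 /=; apply: triple_skip; exists b; split=> //.
      split; first by rewrite /lastm map_rcons last_rcons.
      by rewrite /encode map_rcons rev_rcons.
    have := (bits_ext (rcons w b) 0 u).1.
    have : bits b.+1 <= value_bits by apply: bits_small; have := ltn_ord b; lia.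
    rewrite bits0 bits1 /=; bits_lia.
  move=> _ _ [b [ub [-> ->]]]; apply: IH => //.
  by rewrite size_rcons; lia.
have bi : bits i.+1 <= value_bits.
  by apply: leq_trans (bits_le_self _) _; rewrite /value_bits; lia.
have := bits_subV #|ext k w (lastm w)| (bits_ext w (lastm w).-1 u).1.
have := (bits_ext w (lastm w).-1 u).1; have := (bits_ext w (lastm w).-1 u).2.
have := (bits_ext w (lastm w) u).1; have := bits_small mn.
have : (n.-1 - lastm w) * find_letter_cost <= n * find_letter_cost.
  by rewrite leq_mul2r; lia.
rewrite over_high /= bits1 [i.+1 * _]mulSn /append_letter_cost; move: bi; bits_lia.
Qed.
Local Notation N := #|lexreps n k|.

Lemma bits_card : bits N <= value_bits.
Proof. by apply: leq_trans (bits_card_lexreps n k) _; rewrite /value_bits;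
  clear; lia. Qed.

Definition drawn r : (nat -> nat) := over 0 low0 (regs n k k N r 0 N 0 0).

Lemma triple_prologue cmd0 : let s := @init cmd0 n k 0 [::] in
  triple dc prologue (reg s) (stk s) (call_cost + 12 * value_bits + 40)
    (is_state (drawn 0) (stacks (nil : word n))).
Proof.
move=> s; have n0 : 0 < B := ltn_trans (ltnSn 0) (ltn_trans (ltnSn 1) B_gt2).
have B1 : 1 < B := ltn_trans (ltnSn 1) B_gt2.
have nilE : valid [::] 0 by split=> // -[].
(* The input registers lie below [B], so all 11 registers of the sampler start at 0. *)
apply: (@triple_eq _ _ _ (over 0 (reg s) (nseq 11 0)) _ (stacks (nil : word n))).
- apply/funext => y; rewrite /over; case: ltnP => // By;
  rewrite nth_nseq if_same /=.
  by do 3!(case: eqP => [e|_]; first lia).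
- apply/funext => y; rewrite /over /= if_same; case: ltnP => // By.
  by case: (y - B) => [|[|j]] //=; rewrite nth_nil.
apply: triple_le; last first.
  apply: step_store => //=; apply: step_store => //=.
  apply: step_const_low => //=; apply: step_const_low => //=.
  apply: step_add => /=; apply: step_const => /=; rewrite !addn0.
  rewrite (@eq_over B _ 0 _ low0); last by do 3!case=> //.
  apply: triple_seqS.
    apply: (@triple_call [::] 0 k 0 0 0 0 0 nilE); last by rewrite bits0.
    by rewrite xcountE ext_nil0 bits_card.
  rewrite xcountE ext_nil0; apply: step_add => /=; rewrite addn0.
  exact: triple_skip.
have := bits_card; have : bits n <=
  value_bits by apply: leq_trans (bits_le_self _) _; rewrite /value_bits; lia.
have : bits k <= value_bits by apply: leq_trans (bits_le_self _) _;
  rewrite /value_bits; lia.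
rewrite /= bits0 bits1 !addn0; bits_lia.
Qed.

Lemma triple_epilogue (u : k.-tuple (letter n)) : u \in lexreps n k ->
  triple dc epilogue (drawn (rank u)) (stacks (nil : word n))
    (k * append_letter_cost + 20 * word_weight + 20)
    (fun R H => H 0 = encode (val u)).
Proof.
move=> uL; apply: triple_le; last first.
  apply: (@triple_seq _ _ _ _ _ _ (12 * word_weight.+1)).
    have := @triple_append_letters k [::] u N (add0n k); rewrite ext_nil0 => to.
    exact: to.
  move=> R H ->; apply: (@triple_le _ _ _ _ (12 * (weight (stacks (val u) (B + 0))).+1)).
    rewrite leq_mul2l ltnS over_high weight_rev.
    by apply: weight_encode; rewrite size_tuple.
  apply: triple_post; last first.
    apply: triple_move_stack => //; rewrite inE; lia.
  move=> R' H' [_ ->]; rewrite ifF; last lia.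
  by rewrite over_high /= revK over_low ?cats0 //; lia.
lia.
Qed.

Definition draw_bound := value_bits.+1 + draw_time dc (bits N).

Definition tail_cost := k * append_letter_cost + 20 * word_weight + 20.

Definition sampler_cost :=
  call_cost + 12 * value_bits + 40 + draw_bound + tail_cost + 10.

(** * The draw and the distribution of the output *)

Lemma triple_draw x y R H :
  triple dc (Draw x y) R H ((bits (R y)).+1 + draw_time dc (bits (R y)))
    (fun R' H' => exists2 r, 1 <= r <= maxn 1 (R y) &
       is_state [eta R with x |-> r] H R' H').
Proof.
move=> t; apply: Ends_step => // r r_ok; apply: Ends_halt => //=.
by split; [lia | exists r].
Qed.

Lemma drawnE r : [eta drawn 0 with B + reg_r |-> r] = drawn r :> (nat -> nat).
Proof. by rewrite over_set. Qed.

Lemma drawn_outcomes : maxn 1 (drawn 0 (B + reg_T)) = N.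
Proof. by rewrite /drawn over_high /=; apply/maxn_idPr/card_lexreps_gt0. Qed.

Lemma triple_sampler cmd0 : let s := @init cmd0 n k 0 [::] in
  triple dc sampler (reg s) (stk s) sampler_cost
    (fun R H => exists2 u : k.-tuple (letter n),
       u \in lexreps n k & H 0 = encode (val u)).
Proof.
move=> s; apply: triple_le; last first.
  apply: triple_seqS; first exact: triple_prologue.
  apply: triple_seq; first exact: triple_draw.
  move=> R H [r r_ok [-> ->]]; rewrite drawnE.
  move: r_ok; rewrite drawn_outcomes => /rank_surj[u uL <-].
  by apply: triple_post (triple_epilogue uL) => R' H' ->; exists u.
rewrite /drawn over_high /= /sampler_cost /draw_bound /tail_cost;
  have := bits_card.
bits_lia.
Qed.

Lemma encode_inj : injective (@encode n).
Proof. by apply: inj_map => i j [] /val_inj. Qed.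

Lemma outputs_encode beta (u : word n) s :
  stk s 0 = encode u -> outputs beta s = (braid_of u == beta).
Proof.
move=> su; apply/asboolP/eqP => [[w]|<-]; last by exists u.
by rewrite su => /encode_inj ->.
Qed.

(** Exactly one outcome of the draw leads to [beta], namely the rank of its lex-representative. *)
Lemma yields_sampler beta : beta \in braids n k ->
  yields dc sampler_cost (outputs beta) (1 / (size (braids n k))%:R)%R
    (@init sampler n k 0 [::]).
Proof.
case/lexrep_exists=> ub ubL ubE.
apply: yields_step1 => //=.
apply: triple_yields (triple_prologue sampler) _ => R H t [-> ->] le_t.
split; first by rewrite /sampler_cost; lia.
apply: yields_step1 => //=; first by rewrite /sampler_cost; lia.
set s := Config _ _ _ _.
have out : outcomes s = N := drawn_outcomes.
(* The probability is written as the average of an indicator over the outcomes, the form given by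
   [yields_step]. *)
have -> : (1 / (size (braids n k))%:R =
    (\sum_(1 <= r < (outcomes s).+1) (r == rank ub)%:R) / (outcomes s)%:R :> rat)%R.
  rewrite out size_braids (bigD1_seq (rank ub)) ?iota_uniq //=; last first.
    by rewrite mem_index_iota ltnS rank_bounds.
  by rewrite eqxx big1 ?addr0 // => r /negPf ->.
apply: yields_step => // [|r]; first by rewrite /s /= /sampler_cost; lia.
rewrite out => r_ok; have [u uL ur] := rank_surj r_ok.
rewrite /s /= drawnE -ur.
have -> : (rank u == rank ub) = (braid_of (val u) == beta).
  by rewrite -ubE; apply/eqP/eqP => [/rank_inj->|/lexrep_inj->].
apply: triple_yields (triple_epilogue uL) _ => R' H' t' uH le_t'; split.
  move: le_t'; rewrite /drawn over_high /= /sampler_cost /draw_bound /tail_cost.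
  move: le_t bits_card => /=; move: (draw_time _ _); bits_lia.
have := @yields_halted dc sampler_cost (outputs beta) (Config [::] R' H' t') isT.
by rewrite (@outputs_encode beta (val u)).
Qed.
End Sampler.

(** * Polynomial bounds *)

Definition poly2 (f : nat -> nat -> nat) : Prop :=
  exists a d, forall n k, f n k <= bound2 a d n k.

Lemma poly2_le f g : (forall n k, f n k <= g n k) -> poly2 g -> poly2 f.
Proof.
by move=> fg [a [d gb]]; exists a, d => n k; apply: leq_trans (gb n k).
Qed.

Lemma poly2_bound a d : poly2 (bound2 a d).
Proof. by exists a, d. Qed.

Lemma poly2_const c : poly2 (fun _ _ => c).
Proof. by exists c, 0 => n k; rewrite /bound2 muln1. Qed.

Lemma poly2_n : poly2 (fun n _ => n).
Proof. by exists 1, 1 => n k; rewrite /bound2; lia. Qed.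

Lemma poly2_k : poly2 (fun _ k => k).
Proof. by exists 1, 1 => n k; rewrite /bound2; lia. Qed.

Lemma poly2_add f g : poly2 f -> poly2 g -> poly2 (fun n k => f n k + g n k).
Proof.
move=> [a [d fb]] [a' [d' gb]]; exists (a + a'), (maxn d d') => n k.
rewrite /bound2 mulnDl; apply: leq_add.
  apply: leq_trans (fb n k) _; rewrite leq_mul2l leq_pexp2l ?orbT //.
  exact: leq_maxl.
apply: leq_trans (gb n k) _; rewrite leq_mul2l leq_pexp2l ?orbT //.
exact: leq_maxr.
Qed.

Lemma poly2_mul f g : poly2 f -> poly2 g -> poly2 (fun n k => f n k * g n k).
Proof.
move=> [a [d fb]] [a' [d' gb]]; exists (a * a'), (d + d') => n k.
rewrite /bound2 expnD mulnACA; exact: leq_mul.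
Qed.

Lemma poly2_succ f : poly2 f -> poly2 (fun n k => (f n k).+1).
Proof.
move=> pf; apply: (poly2_le _ (poly2_add pf (poly2_const 1))) => n k.
by rewrite addn1.
Qed.

Lemma poly2_exp f e : poly2 f -> poly2 (fun n k => f n k ^ e).
Proof.
move=> pf; elim: e => [|e IH]; first exact: poly2_const.
by apply: (poly2_le _ (poly2_mul pf IH)) => n k; rewrite expnS.
Qed.

Ltac poly2_tac :=
  repeat first [exact: poly2_const | exact: poly2_n | exact: poly2_k
    | exact: poly2_bound | apply: poly2_exp | apply: poly2_succ
    | apply: poly2_add | apply: poly2_mul ].

Lemma poly2_value_bits : poly2 value_bits.
Proof. by rewrite /value_bits; poly2_tac. Qed.

Lemma poly2_call_cost B a d : poly2 (fun n k => call_cost B n k a d).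
Proof. by rewrite /call_cost /counter_memory /word_weight /value_bits;
  poly2_tac. Qed.

Lemma leq_pow_succ a d x y : x <= y -> a * x.+1 ^ d <= a * y.+1 ^ d.
Proof.
by case: d => // d xy; rewrite leq_mul2l leq_exp2r // ltnS xy orbT.
Qed.

Lemma poly2_sampler_cost dc B a d : polybound (draw_time dc) ->
  poly2 (fun n k => sampler_cost dc B n k a d).
Proof.
case=> at_ [dt drt]; apply: (@poly2_le _ (fun n k =>
    call_cost B n k a d + 12 * value_bits n k + 40 +
    ((value_bits n k).+1 + at_ * (value_bits n k).+1 ^ dt) +
    (k * append_letter_cost B n k a d + 20 * word_weight n k + 20) + 10)) => [n k|].
  (* The polynomial bound is applied at [bits N] first; being monotone, unlike possibly
     [draw_time dc], it then allows passing to [value_bits]. *)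
  have le_dt := leq_trans (drt _) (leq_pow_succ at_ dt (bits_card n k)).
  rewrite /sampler_cost /draw_bound /tail_cost; lia.
by rewrite /append_letter_cost /find_letter_cost; poly2_tac; first [exact: poly2_value_bits
  | exact: poly2_call_cost | rewrite /word_weight; poly2_tac].
Qed.

Lemma poly2_total T a d : poly2 T ->
  poly2 (fun n k => n + k + T n k + a * (n + k + T n k).+1 ^ d).
Proof. by move=> pT; poly2_tac. Qed.

Theorem theorem2p3 (dc : draw_cost)
  (draw_time_poly : polybound (draw_time dc))
  (draw_space_poly : polybound (draw_space dc)) :
  (exists c : cmd, polytime_counts dc c) ->
  exists c : cmd, polytime_samples_uniformly dc c.
Proof.
case: draw_space_poly => as_ [ds drs].
(* With this [B], the variables of the sampler lie beyond all those of [c] and of its input. *)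
move=> [c [a [d counts]]]; set B := nvars c.
have B_gt2 : 2 < B by rewrite /B /nvars leq_max.
have width_c : width c <= B by rewrite /B /nvars leq_max leqnn orbT.
have count_c n k : 1 < n -> forall w m, @valid n k w m ->
    runs_within dc B (init c k m w) (bound2 a d n k)
      (memory B (init c k m w) + bound2 a d n k)
      (fun s' => reg s' 0 = xcount k w m).
  by move=> n1 w m [_ mn lastw]; apply: counts.
pose T n k := sampler_cost dc B n k a d.
pose S n k := as_ * (n + k + T n k).+1 ^ ds.
(* One polynomial serves for time and space: [n + k] bounds the initial memory, [T] its growth, and
   [S] the space of a draw. *)
have [a' [d' le_TS]] : poly2 (fun n k => n + k + T n k + S n k).
  exact/poly2_total/poly2_sampler_cost.
exists (sampler c B), a', d' => n k n1 s.
have leT : T n k <= bound2 a' d' n k by have := le_TS n k; lia.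
split; last first.
  move=> beta betaP; apply: (yields_sampler n1 B_gt2 width_c (count_c n k n1) betaP).
  by rewrite addn0.
have run := triple_sampler n1 B_gt2 width_c (count_c n k n1) (sampler c B).
have mem b' : memory b' s <= n + k.
  by apply: leq_trans (memory_init _ _ _ _ _) _; rewrite /weight big_nil !addn0.
have drS v : v <= n + k + T n k -> draw_space dc v <= S n k.
  by move=> vT; apply: leq_trans (drs v) _; apply: leq_pow_succ.
move=> s' rs.
have [cT mS out] := @triple_runs_within _ _ _ _ _ _ (nvars (sampler c B)) run
  (n + k) mem (S n k) drS s' rs.
split; first exact: leq_trans leT.
  exact: leq_trans mS (le_TS n k).
move/out=> [u uL uE]; exists (braid_of (val u)); first exact: mem_braids.
by rewrite (outputs_encode _ uE) eqxx.
Qed.
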